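(* Let $\mathscr{F}$ be a sheaf of functions on $\Omega$ satisfying property $(\mathscr{F}1)$, let $X\subseteq\Omega$ be open, let $w:X\to\mathbb{K}$ and $\psi:X\to X$ be continuous, and assume that the weighted composition operator $C_{w,\psi}:\mathscr{F}(X)\to\mathscr{F}(X)$, $f\mapsto w\cdot(f\circ\psi)$, is well-defined. Assume that additionally the following conditions hold. (a) There is an open, relatively compact exhaustion $(X_n)_{n\in\mathbb{N}}$ of $X$ such that for each $n\in\mathbb{N}$, every $x\in X\setminus\overline{X}_n$ and every open $W\subseteq X\setminus\overline{X}_n$ containing $x$ there is an open $U\subseteq W$ with $x\in U$ for which the restriction $r_X^{X_n\cup U}:\mathscr{F}(X)\to\mathscr{F}(X_n\cup U)$ has dense range. (b) $\ker\delta_x\neq\mathscr{F}(X)$ for each $x\in X$. (c) For every $m\in\mathbb{N}_0$ the set $\{y\in X:\ w(\psi^m(y))\neq 0\}$ is dense in $X$. If $C_{w,\psi}$ is topologizable on $\mathscr{F}(X)$, then $\psi$ has stable orbits.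
   Context: $\mathbb{K}\in\{\mathbb{R},\mathbb{C}\}$; $\Omega$ is a locally compact, $\sigma$-compact, non-compact Hausdorff space. A sheaf of functions $\mathscr{F}$ on $\Omega$ assigns to every open $X\subseteq\Omega$ a vector space $\mathscr{F}(X)$ of $\mathbb{K}$-valued functions on $X$ such that for open $Y\subseteq X$ the restriction $r_X^Y:\mathscr{F}(X)\to\mathscr{F}(Y)$, $f\mapsto f_{|Y}$, is well-defined, functions in $\mathscr{F}(X)$ agreeing on all members of an open cover of $X$ are equal, and for every open cover $(X_\iota)_{\iota\in I}$ of $X$ and $f_\iota\in\mathscr{F}(X_\iota)$ with $f_\iota=f_\kappa$ on $X_\iota\cap X_\kappa$ for all $\iota,\kappa\in I$ there is $f\in\mathscr{F}(X)$ with $f_{|X_\iota}=f_\iota$ for all $\iota$. An open, relatively compact exhaustion of $X$ is a sequence $(X_n)$ of open subsets of $X$ with compact closures $\overline{X}_n\subseteq X_{n+1}$ and $\bigcup_n X_n=X$. $\mathscr{F}$ satisfies $(\mathscr{F}1)$ if for every open $X\subseteq\Omega$: $\mathscr{F}(X)$ is a webbed and ultrabornological Hausdorff locally convex space; $\mathscr{F}(X)\subseteq C(X)$ (continuous $\mathbb{K}$-valued functions); for each $x\in X$ the point evaluation $\delta_x:f\mapsto f(x)$ is a continuous linear functional on $\mathscr{F}(X)$; and for every open, relatively compact exhaustion $(X_n)$ of $X$ the canonical map $f\mapsto(f_{|X_n})_n$ is a topological isomorphism of $\mathscr{F}(X)$ onto the projective limit $\{(f_n)_n\in\prod_n\mathscr{F}(X_n):\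 f_n=f_{n+1|X_n}\ \forall n\}$ (with the topology induced by the product). (These conditions imply that restrictions and $C_{w,\psi}$ are continuous.) $\psi^m$ is the $m$-fold iterate of $\psi$ ($\psi^0=\mathrm{id}$). A continuous map $\psi:X\to X$ has stable orbits if for every compact $K\subseteq X$ there is a compact $L\subseteq X$ with $\psi^m(K)\subseteq L$ for all $m\in\mathbb{N}$. A continuous linear operator $T$ on a locally convex space $E$ is topologizable if for every continuous seminorm $p$ on $E$ there is a continuous seminorm $q$ on $E$ such that for every $m\in\mathbb{N}$ there is $\gamma_m>0$ with $p(T^m x)\le\gamma_m q(x)$ for all $x\in E$. *)

(* Defs.v *)
From mathcomp Require Import all_boot all_order all_algebra.
From mathcomp Require Import all_classical all_reals all_analysis.
From mathcomp Require Import complex.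
Import Order.TTheory GRing.Theory Num.Theory.
Import numFieldNormedType.Exports.

Set Implicit Arguments.
Unset Strict Implicit.
Unset Printing Implicit Defensive.

Local Open Scope classical_set_scope.
Local Open Scope ring_scope.

Definition real_or_complex (R : realType) (K : numFieldType) : Prop :=
  K = R :> numFieldType \/ K = R[i] :> numFieldType.

Definition sigma_compact (T : topologicalType) : Prop :=
  exists2 A : nat -> set T,
    (forall n, compact (A n)) & \bigcup_n A n = [set: T].

Section LocallyConvexSpaces.
Context (K : numFieldType) (E : tvsType K).

(* Values are in K, as for norms in the library; 0 <= p x forces p x to be
   real when K is the field of complex numbers. *)
Definition continuous_seminorm (p : E -> K) : Prop :=
  [/\ forall x, 0 <= p x,
      forall x y, p (x + y) <= p x + p y,
      forall (a : K) x, p (a *: x) = `|a| * p x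
    & continuous (p : E -> K^o)].

Definition absolutely_convex (A : set E) : Prop :=
  forall (a b : K) (x y : E), `|a| + `|b| <= 1 -> A x -> A y ->
    A (a *: x + b *: y).

Definition scale_set (a : K) (A : set E) : set E := [set a *: x | x in A].

Definition absorbs (A B : set E) : Prop :=
  exists2 r : K, 0 < r & forall c : K, r <= `|c| -> B `<=` scale_set c A.

Definition tvs_bounded (B : set E) : Prop :=
  forall U : set E, nbhs 0 U -> absorbs U B.

(* A bounded absolutely convex set B whose linear span is complete for the
   gauge of B.  Since the gauge p satisfies
   {p < e} `<=` e B `<=` {p <= e}, Cauchy sequences and limits for p are
   expressed with the sets e B. *)
Definition Banach_disk (B : set E) : Prop :=
  [/\ absolutely_convex B, tvs_bounded B
    & forall u : nat -> E,
        (forall n, exists2 r : K, 0 < r & scale_set r B (u n)) ->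
        (forall e : K, 0 < e -> exists N, forall m n,
           (N <= m)%N -> (N <= n)%N -> scale_set e B (u m - u n)) ->
        exists2 l : E, exists2 r : K, 0 < r & scale_set r B l &
          forall e : K, 0 < e -> exists N, forall n,
            (N <= n)%N -> scale_set e B (u n - l)].

Definition ultrabornological : Prop :=
  forall A : set E, absolutely_convex A ->
    (forall B, Banach_disk B -> absorbs A B) -> nbhs 0 A.

(* De Wilde: C [:: n_1; ...; n_k] is the set of the web with that
   multi-index, and C [::] is the whole space. *)
Definition web (C : seq nat -> set E) : Prop :=
  [/\ forall s, absolutely_convex (C s),
      C [::] = [set: E],
      forall s, C s = \bigcup_n C (rcons s n)
    & forall i : nat -> nat, exists2 a : nat -> K, forall k, 0 < a k &
        forall x : nat -> E, (forall k, C (mkseq i k.+1) (x k)) ->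
          exists l : E, series (fun k => a k *: x k : E) @ \oo --> l].

Definition webbed : Prop := exists C, web C.

(* N starts at 1.  For linear T the case m = 1 entails that T is
   continuous. *)
Definition topologizable (T : E -> E) : Prop :=
  forall p, continuous_seminorm p ->
    exists2 q, continuous_seminorm q &
      forall m, (0 < m)%N -> exists2 gamma : K, 0 < gamma &
        forall x, p (iter m T x) <= gamma * q x.

End LocallyConvexSpaces.

(* A vector space of K-valued functions on T with pointwise operations,
   endowed with a locally convex topology: a locally convex space whose
   elements are identified with functions by an injective linear map. *)
Record function_space (K : numFieldType) (T : Type) := FunctionSpace {
  function_space_tvs :> tvsType K ;
  val_at : function_space_tvs -> T -> K ;
  val_at_linear : forall (a : K) f g x,
    val_at (a *: f + g) x = a * val_at f x + val_at g x ;
  val_at_inj : injective val_at }.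

Section Sheaves.
Context (K : numFieldType) (Omega : topologicalType).

(* Only the values of F at open sets are ever constrained or used. *)
Context (F : forall X : set Omega, function_space K X).

(* Equality on X `&` Y; for Y `<=` X it says that g is the restriction
   of f to Y. *)
Definition coincide (X Y : set Omega) (f : F X) (g : F Y) : Prop :=
  forall (x : X) (y : Y), \val x = \val y -> val_at f x = val_at g y.

Definition open_cover (X : set Omega) (I : Type) (U : I -> set Omega) : Prop :=
  (forall i, open (U i)) /\ \bigcup_i U i = X.

Definition is_sheaf : Prop :=
  [/\ forall X Y : set Omega, open X -> open Y -> Y `<=` X ->
        forall f : F X, exists g : F Y, coincide f g,
      forall X : set Omega, open X ->
        forall (I : Type) (U : I -> set Omega), open_cover X U ->
        forall f g : F X,
        (forall i (x : X), U i (\val x) -> val_at f x = val_at g x) -> f = g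
    & forall X : set Omega, open X ->
        forall (I : Type) (U : I -> set Omega), open_cover X U ->
        forall f : forall i, F (U i),
        (forall i j, coincide (f i) (f j)) ->
        exists g : F X, forall i, coincide g (f i)].

Definition restr (X Y : set Omega) (f : F X) : F Y :=
  xget 0 [set g | coincide f g].

Definition exhaustion (X : set Omega) (Xn : nat -> set Omega) : Prop :=
  [/\ forall n, open (Xn n) /\ Xn n `<=` X,
      forall n, compact (closure (Xn n)),
      forall n, closure (Xn n) `<=` Xn n.+1
    & \bigcup_n Xn n = X].

Definition restr_seq (X : set Omega) (Xn : nat -> set Omega) (f : F X) :
    prod_topology (fun n => F (Xn n)) :=
  fun n => restr (Xn n) f.
Arguments restr_seq : clear implicits.

Definition projective_limit (Xn : nat -> set Omega) :
    set (prod_topology (fun n => F (Xn n))) :=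
  [set g | forall n, g n = restr (Xn n) (g n.+1)].
Arguments projective_limit : clear implicits.

(* Linearity of [restr_seq] is automatic. *)
Definition topological_iso_projective_limit
    (X : set Omega) (Xn : nat -> set Omega) : Prop :=
  [/\ continuous (restr_seq X Xn),
      range (restr_seq X Xn) = projective_limit Xn
    & exists2 h : prod_topology (fun n => F (Xn n)) -> F X,
        cancel (restr_seq X Xn) h & {within projective_limit Xn, continuous h}].

Definition property_F1 : Prop :=
  forall X : set Omega, open X ->
  [/\ [/\ webbed (F X), ultrabornological (F X) & hausdorff_space (F X)],
      forall f : F X, continuous (val_at f : X -> K^o),
      forall x : X, continuous (fun f : F X => val_at f x : K^o)
    & forall Xn, exhaustion X Xn -> topological_iso_projective_limit X Xn].

Definition weighted_composition (X : set Omega) (w : X -> K) (psi : X -> X)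
    (C : F X -> F X) : Prop :=
  forall f x, val_at (C f) x = w x * val_at f (psi x).

End Sheaves.

Definition stable_orbits (T : topologicalType) (psi : T -> T) : Prop :=
  forall A : set T, compact A ->
    exists2 L : set T, compact L &
      forall m, (0 < m)%N -> iter m psi @` A `<=` L.

(* Main.v *)
(* Let A be compact in X, A `<=` X_j, and p f = sup of |f| over the
   closure of X_j; p is a continuous seminorm because F(X) is ultrabornological
   (Banach-Steinhaus on Banach disks).  Topologizability gives q, and since
   F(X) is the projective limit of the F(X_n), q is controlled by the
   restrictions to X_0, ..., X_N for some N.  If psi^m leaves the closure of X_N
   at a point of A, then by density of the points where w (psi^i y) != 0 it does
   so at some y in X_j with nonzero weight product P.  By (a), glue 0 on X_N
   with a function taking a large value at z = psi^m y on U and approximate by f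
   in F(X): q f < 1 while |P| |f z| <= p (C^m f) <= gamma q f is as large as we
   please.  The approximation needs continuity of the restriction maps, i.e.
   De Wilde's closed graph theorem, proved by a Baire argument in the span of a
   Banach disk. *)

Require Import Defs.
From mathcomp Require Import all_boot all_order all_algebra.
From mathcomp Require Import all_classical all_reals all_analysis.
From HB Require Import structures.
From mathcomp Require Import complex ring.
Import Order.TTheory GRing.Theory Num.Theory.
Import numFieldNormedType.Exports.
Set Implicit Arguments.
Unset Strict Implicit.
Unset Printing Implicit Defensive.
Local Open Scope classical_set_scope.
Local Open Scope ring_scope.

(** * Suprema and the Archimedean property in the real or complex field *)

Section RealOrComplex.
Context (R : realType) (K : numFieldType) (hK : real_or_complex R K).

(** In the complex order only numbers with the same imaginary part are comparable, so the elements
    of S are real and the supremum of their real parts serves. *)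
Lemma nonneg_has_lub (S : set K) (b : K) :
  S !=set0 -> (forall x, S x -> 0 <= x <= b) ->
  exists2 s, ubound S s & forall u, ubound S u -> s <= u.
Proof.
case: hK S b => ->.
  move=> S b S0 Sb; exists (sup S); last by move=> u; exact: ge_sup.
  apply: ub_le_sup; exists b => x /Sb /andP[_] //.
move=> S b [x0 Sx0] Sb.
have Im0 x : S x -> complex.Im x = 0.
  by case: x => x1 x2 /Sb /andP[]; rewrite lecE /= => /andP[/eqP].
pose S' := [set complex.Re x | x in S].
have S'0 : S' !=set0 by exists (complex.Re x0), x0.
exists (sup S')%:C%C.
  move=> x Sx; rewrite lecE (Im0 _ Sx) eqxx /=.
  apply: ub_le_sup; last by exists x.
  by exists (complex.Re b) => _ [y /Sb /andP[_ ] + <-]; rewrite lecE => /andP[].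
move=> [u1 u2] uS; rewrite lecE /=; apply/andP; split.
  by have := uS _ Sx0; rewrite lecE (Im0 _ Sx0) => /andP[].
apply: ge_sup => // _ [y Sy <-].
by have := uS _ Sy; rewrite lecE => /andP[].
Qed.

(** Were the natural numbers bounded by x, their least upper bound s would satisfy s <= s - 1. *)
Lemma nonneg_lt_nat (x : K) : 0 <= x -> exists n : nat, x < n%:R.
Proof.
move=> x0; apply: contrapT => /forallNP xn.
have nx (n : nat) : n%:R <= x.
  by case: (real_ltP (ger0_real x0) (realn K n)) => // /xn.
have [||s us ls] := @nonneg_has_lub [set n%:R | n in [set: nat]] x.
- by exists 0%:R, 0%N.
- by move=> _ [n _ <-]; rewrite ler0n nx.
suff : s <= s - 1 by rewrite lerBrDr gerDl ler10.
apply: ls => _ [n _ <-]; rewrite lerBrDr natr1.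
by apply: us; exists n.+1.
Qed.

Lemma pow2_lt (x : K) : 0 < x -> exists n : nat, 2^-1 ^+ n < x.
Proof.
move=> x0; have [|n xn] := @nonneg_lt_nat x^-1; first by rewrite invr_ge0 ltW.
exists n; rewrite exprVn -[x]invrK ltf_pV2 ?posrE ?exprn_gt0 ?invr_gt0//.
apply: (lt_trans xn); rewrite -natrX ltr_nat; exact: ltn_expl.
Qed.

End RealOrComplex.

(** The order of K may be partial, but positive elements are real and hence comparable. *)
Lemma pos_lower_bound (K : numFieldType) (a b : K) : 0 < a -> 0 < b ->
  exists2 m, 0 < m & (m <= a) && (m <= b).
Proof.
move=> a0 b0; have /orP[ab|ba] := real_leVge (gtr0_real a0) (gtr0_real b0).
  by exists a => //; rewrite lexx.
by exists b => //; rewrite lexx andbT.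
Qed.

(** * Absolutely convex sets and neighbourhoods of 0 *)

Section AbsolutelyConvex.
Context (K : numFieldType) (E : tvsType K).
Implicit Types (A B : set E) (x y : E).

Lemma absolutely_convexZ A (a : K) x : absolutely_convex A ->
  `|a| <= 1 -> A x -> A (a *: x).
Proof.
move=> cA a1 Ax; have := cA a 0 x x.
by rewrite scale0r addr0 normr0 addr0; exact.
Qed.

Lemma absolutely_convex0 A : absolutely_convex A -> A !=set0 -> A 0.
Proof.
move=> cA [x Ax]; have := @absolutely_convexZ _ 0 x cA.
by rewrite normr0 scale0r; apply.
Qed.

Lemma scale_setE (r : K) A x : r != 0 -> scale_set r A x <-> A (r^-1 *: x).
Proof.
move=> r0; split=> [[y Ay <-]|Ax]; first by rewrite scalerA mulVf// scale1r.
by exists (r^-1 *: x) => //; rewrite scalerA divff// scale1r.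
Qed.

Lemma sub_scale_set (r s : K) A : absolutely_convex A ->
  `|r| <= `|s| -> scale_set r A `<=` scale_set s A.
Proof.
move=> cA rs _ [y Ay <-]; have [s0|s0] := eqVneq s 0.
  move: rs; rewrite s0 normr0 normr_le0 => /eqP ->.
  by exists y.
apply/scale_setE => //; rewrite scalerA; apply: absolutely_convexZ => //.
by rewrite normrM normfV mulrC ler_pdivrMr ?normr_gt0// mul1r.
Qed.

Lemma scale_setD (r s : K) A x y : absolutely_convex A -> 0 <= r -> 0 <= s ->
  scale_set r A x -> scale_set s A y -> scale_set (r + s) A (x + y).
Proof.
move=> cA r0 s0 [x' Ax' <-] [y' Ay' <-]; have [rs0|rs0] := eqVneq (r + s) 0.
  move/eqP: (rs0); rewrite paddr_eq0// => /andP[/eqP -> /eqP ->].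
  by exists x' => //; rewrite addr0 !scale0r addr0.
have rs : 0 < r + s by rewrite lt_neqAle eq_sym rs0 addr_ge0.
apply/scale_setE => //; rewrite scalerDr !scalerA; apply: cA => //.
rewrite !normrM normfV (gtr0_norm rs) !ger0_norm// -mulrDr mulVf//.
Qed.

Lemma scale_setZ (a r : K) A x :
  scale_set r A x -> scale_set (a * r) A (a *: x).
Proof. by move=> [y Ay <-]; exists y; rewrite // scalerA. Qed.

Lemma scale_setN (r : K) A x : absolutely_convex A ->
  scale_set r A x -> scale_set r A (- x).
Proof.
move=> cA /(@scale_setZ (-1)); rewrite scaleN1r mulN1r.
by apply: sub_scale_set => //; rewrite normrN.
Qed.

Lemma scale_set_le (r s : K) A x : absolutely_convex A -> 0 <= r ->
  r <= s -> scale_set r A x -> scale_set s A x.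
Proof.
move=> cA r0 rs; apply: sub_scale_set => //.
by rewrite !ger0_norm// (le_trans r0).
Qed.

Lemma bounded_scale_sub B U : tvs_bounded B -> nbhs 0 U ->
  exists2 e : K, 0 < e & scale_set e B `<=` U.
Proof.
move=> bB /bB[r r0 rU]; exists r^-1; first by rewrite invr_gt0.
have := rU r; rewrite ger0_norm ?(ltW r0)// => /(_ (lexx _)) BU _ [x /BU[y Uy <-] <-].
by rewrite scalerA mulVf ?scale1r// gt_eqF.
Qed.

Lemma absorbs_scale_sub A B (e : K) : absolutely_convex B -> 0 < e ->
  scale_set e B `<=` A -> absorbs A B.
Proof.
move=> cB e0 eBA; exists e^-1; first by rewrite invr_gt0.
move=> c ec x Bx; have c0 : c != 0.
  by rewrite -normr_gt0 (lt_le_trans _ ec)// invr_gt0.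
apply/scale_setE => //; apply: eBA.
apply: (@sub_scale_set c^-1) => //; last by exists x.
by rewrite normfV (gtr0_norm e0) -[e]invrK lef_pV2// ?posrE ?invr_gt0// (lt_le_trans _ ec)// invr_gt0.
Qed.

(* A convex neighbourhood is made balanced by keeping the points whose
   multiples by the closed unit disk of [K] all stay in it. *)
Lemma nbhs0_absolutely_convex U : nbhs (0 : E) U ->
  exists V, [/\ nbhs 0 V, absolutely_convex V & V `<=` U].
Proof.
move=> U0; have [B cB [oB Bbase]] := @locally_convex K E.
have [W [BW W0] WU] := Bbase _ _ U0.
have nW : nbhs 0 W by apply: open_nbhs_nbhs; split=> //; exact: oB.
exists [set x | forall a : K, `|a| <= 1 -> W (a *: x)]; split.
- have := @scale_continuous K E (0, 0) W; rewrite /= scale0r => /(_ nW).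
  move=> [[P Q] [/= [d /= d0 dP] Q0] PQW].
  have d20 : d / 2 != 0 by rewrite gt_eqF// divr_gt0.
  apply: filterS (nbhs0Z d20 Q0) => _ [y Qy <-] a a1.
  rewrite scalerA; apply: (PQW (a * (d / 2), y)); split => //=; apply: dP => /=.
  rewrite sub0r normrN normrM (gtr0_norm (divr_gt0 d0 _))//.
  rewrite (@le_lt_trans _ _ (d / 2))// ?ler_piMl// ?divr_ge0 ?ltW//.
  by rewrite ltr_pdivrMr// ltr_pMr// ltr1n.
- have /convex_setW cW : convex_set W by apply: cB; rewrite inE.
  have {}cW (t : K) x y : 0 <= t <= 1 -> W x -> W y -> W (t *: x + (1 - t) *: y).
    move=> /andP[t0 t1] Wx Wy; pose p : {i01 K} := Itv01 t0 t1.
    by apply/set_mem; apply: (cB W _ x y p); rewrite ?inE.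
  move=> a b x y ab Wx Wy c c1.
  have a1 : `|a| <= 1 by apply: le_trans ab; rewrite lerDl.
  have ba : `|b| <= 1 - `|a| by rewrite lerBrDl.
  (* Convexity needs weights with sum 1: [|a|] and 1 - [|a|] are used, and the remaining scalars
     have modulus at most 1, so that x and y absorb them. Where a denominator vanishes, so does the
     numerator. *)
  have -> : c *: (a *: x + b *: y) =
     `|a| *: ((c * (a / `|a|)) *: x) +
     (1 - `|a|) *: ((c * (b / (1 - `|a|))) *: y).
    rewrite scalerDr !scalerA; congr (_ *: _ + _ *: _).
      have [->|a0] := eqVneq a 0; first by rewrite normr0 !mul0r mulr0.
      by rewrite [RHS]mulrCA [`|a| * _]mulrCA divff ?mulr1// normr_eq0.
    have [e|e] := eqVneq (1 - `|a|) 0; last by rewrite [RHS]mulrCA [(1 - _) * _]mulrCA divff ?mulr1.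
    move: ba; rewrite e normr_le0 => /eqP ->.
    by rewrite !mul0r mulr0.
  apply: cW; first by rewrite normr_ge0.
  + apply: Wx; rewrite normrM mulr_ile1// normrM normfV normr_id.
    by have [->|a0] := eqVneq a 0; rewrite ?normr0 ?mul0r// divff// normr_eq0.
  + apply: Wy; rewrite normrM mulr_ile1// normrM normfV.
    rewrite (ger0_norm (le_trans _ ba))//.
    have [->|e] := eqVneq (1 - `|a|) 0; first by rewrite invr0 mulr0.
    by rewrite ler_pdivrMr ?mul1r// lt_neqAle eq_sym e (le_trans _ ba).
- by move=> x /(_ 1); rewrite normr1 scale1r => /(_ (lexx _)) /WU.
Qed.

Lemma nbhs0_split U : nbhs (0 : E) U ->
  exists2 V, nbhs 0 V & forall x y, V x -> V y -> U (x + y).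
Proof.
move=> U0; have := @add_continuous E (0, 0) U; rewrite /= addr0 => /(_ U0).
move=> [[P Q] [/= P0 Q0] PQU]; exists (P `&` Q); first exact: filterI.
by move=> x y [Px _] [_ Qy]; apply: (PQU (x, y)).
Qed.

End AbsolutelyConvex.

(** * Baire category in the span of a Banach disk *)

Section BanachDisks.
Context (R : realType) (K : numFieldType) (hK : real_or_complex R K).
Context (E : tvsType K) (B : set E) (hB : Banach_disk B) (B0 : B !=set0).

Definition disk_span : set E := [set x | exists2 r : K, 0 < r & scale_set r B x].

(* The closure of S for the gauge of B has an interior point. *)
Definition somewhere_dense (S : set E) : Prop :=
  exists x, exists2 r : K, 0 < r &
    forall y, scale_set r B (y - x) -> forall s : K, 0 < s ->
      exists2 u, S u & scale_set s B (u - y).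

(** This refers to the group topology on all of E whose neighbourhoods of 0 are generated by the
    multiples r B with r > 0; [disk_span] is open for it, and the centre in [somewhere_dense] may be
    any point of E. *)
Definition meager (S : set E) : Prop :=
  exists2 N : nat -> set E, forall n, ~ somewhere_dense (N n)
    & S `<=` \bigcup_n N n.

Let cB : absolutely_convex B. Proof. by case: hB. Qed.

Lemma scale_disk0 (r : K) : scale_set r B 0.
Proof. by exists 0; [exact: absolutely_convex0|rewrite scaler0]. Qed.

Lemma disk_span_sum (x y : E) (r : K) :
  disk_span x -> 0 < r -> scale_set r B (y - x) -> disk_span y.
Proof.
move=> [s s0 sx] r0 ryx; exists (r + s); first exact: addr_gt0.
by rewrite -(subrK x y); apply: scale_setD => //; apply: ltW.
Qed.

(* The Baire category theorem for the Banach space spanned by B. *)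
Lemma disk_span_not_meager : ~ meager disk_span.
Proof.
move=> [N Nnd NB].
(* Pairs are closed balls (centre, radius); the new ball avoids [N n]. Moving the centre by a
   quarter of the radius while halving the radius keeps all later centres within half the radius, so
   their limit stays in every ball. *)
pose P n (xr yr : E * K) := scale_set (xr.2 / 4) B (yr.1 - xr.1) /\
  [/\ 0 < yr.2, yr.2 <= xr.2 / 2 &
    forall u, scale_set yr.2 B (u - yr.1) -> ~ N n u].
have stepP n (xr : E * K) : exists yr, 0 < xr.2 -> P n xr yr.
  have [r0|] := pselect (0 < xr.2); last by exists xr.
  have r4 : 0 < xr.2 / 4 by rewrite divr_gt0.
  have r2 : 0 < xr.2 / 2 by rewrite divr_gt0.
  have /forallNP/(_ xr.1)/forall2NP/(_ (xr.2 / 4))[//|] := Nnd n.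
  move=> /existsNP[y] /not_implyP[yx] /existsNP[s] /not_implyP[s0] sN.
  have [t t0 /andP[ts tr]] := pos_lower_bound s0 r2.
  exists (y, t) => _; split=> //; split=> // u ut Nu; apply: sN.
  by exists u => //; apply: scale_set_le ut => //; apply: ltW.
have [f fP] : {f : nat -> E * K -> E * K | forall n xr, 0 < xr.2 -> P n xr (f n xr)}.
  have /choice[f fP] : forall nxr : nat * (E * K), exists yr, 0 < nxr.2.2 -> P nxr.1 nxr.2 yr.
    by move=> [n xr]; exact: stepP.
  by exists (fun n xr => f (n, xr)) => n xr; exact: (fP (n, xr)).
pose z := fix z n := if n is m.+1 then f m (z m) else (0 : E, 1 : K).
have zpos n : 0 < (z n).2 by elim: n => [|n IH] //=; case: (fP n _ IH) => _ [].
have zP n : P n (z n) (z n.+1) by exact: fP.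
have zle n : (z n).2 <= 2^-1 ^+ n.
  elim: n => [|n IH]; first by rewrite expr0.
  case: (zP n) => _ [_ + _] => /le_trans; apply.
  by rewrite exprSr ler_pM2r ?invr_gt0.
have zmono n m : (n <= m)%N -> (z m).2 <= (z n).2.
  elim: m => [|m IH]; first by rewrite leqn0 => /eqP ->.
  rewrite leq_eqVlt => /predU1P[-> //|/IH]; apply: le_trans.
  case: (zP m) => _ [_ + _] => /le_trans; apply.
  by rewrite ler_pdivrMr// ler_peMr ?ltW// ltr1n.
(* The bound telescopes: since r_{m+1} <= r_m / 2, the move r_m / 4 is at most (r_m - r_{m+1}) /
   2. *)
have zdist n m : (n <= m)%N ->
    scale_set (((z n).2 - (z m).2) / 2) B ((z m).1 - (z n).1).
  elim: m => [|m IH].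
    by rewrite leqn0 => /eqP ->; rewrite [X in scale_set _ _ X]subrr; exact: scale_disk0.
  rewrite leq_eqVlt => /predU1P[<-|]; last rewrite ltnS => nm.
    by rewrite [X in scale_set _ _ X]subrr; exact: scale_disk0.
  have {}IH := IH nm.
  have [zm [zm0 zm2 _]] := zP m.
  rewrite -(subrK (z m).1 (z m.+1).1) -addrA.
  apply: (@scale_set_le _ _ ((z m).2 / 4 + ((z n).2 - (z m).2) / 2)) => //.
  - by rewrite addr_ge0 ?divr_ge0 ?subr_ge0 ?zmono ?ltW.
  - rewrite -subr_ge0 (_ : _ - _ = ((z m).2 / 2 - (z m.+1).2) / 2); last by field.
    by rewrite divr_ge0 ?subr_ge0.
  - by apply: scale_setD => //; rewrite ?divr_ge0 ?subr_ge0 ?zmono ?ltW.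
have zspan n : disk_span (z n).1.
  elim: n => [|n IH]; first by exists 1 => //; exact: scale_disk0.
  have [zn _] := zP n; apply: (disk_span_sum IH _ zn).
  by rewrite divr_gt0.
have zhalf n m : (n <= m)%N -> scale_set ((z n).2 / 2) B ((z m).1 - (z n).1).
  move=> nm; apply: scale_set_le (zdist _ _ nm) => //.
    by rewrite divr_ge0 ?subr_ge0 ?zmono.
  by rewrite ler_pM2r ?invr_gt0// gerBl ltW.
have [_ _ /(_ (fst \o z))[//||l lspan lP]] := hB.
  move=> e e0; have [M Me] := pow2_lt hK e0; exists M => m n Mm Mn.
  apply: (@scale_set_le _ _ ((z M).2 / 2 + (z M).2 / 2)) => //.
  - by rewrite addr_ge0// divr_ge0 ?ltW.
  - by rewrite -splitr (le_trans (zle M))// ltW.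
  - rewrite /= -(subrK (z M).1 (z m).1) -addrA.
    apply: scale_setD; rewrite ?divr_ge0 ?ltW//; first exact: zhalf.
    by rewrite -opprB; apply/scale_setN/zhalf.
have [n _ Nl] := NB _ lspan.
have [_ [_ _ /(_ l)]] := zP n; apply=> //.
have z2 : 0 < (z n.+1).2 / 2 by rewrite divr_gt0.
have [M MP] := lP _ z2.
rewrite [X in scale_set X](splitr (z n.+1).2) -(subrK (z (maxn M n.+1)).1 l) -addrA.
apply: scale_setD; rewrite ?ltW//; last by apply/zhalf/leq_maxr.
by rewrite -opprB; apply/scale_setN/MP => //; exact: leq_maxl.
Qed.

Lemma sub_meager (S T : set E) : S `<=` T -> meager T -> meager S.
Proof. by move=> ST [N NP TN]; exists N => // x /ST/TN. Qed.

Lemma bigcup_meager (S : nat -> set E) :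
  (forall n, meager (S n)) -> meager (\bigcup_n S n).
Proof.
move=> Sm; have /choice[N /all_and2[NP SN]] : forall n, exists N : nat -> set E,
    (forall m, ~ somewhere_dense (N m)) /\ S n `<=` \bigcup_m N m.
  by move=> n; have [N] := Sm n; exists N.
exists (fun k => if unpickle k is Some (n, m) then N n m else set0).
  move=> k; case: (unpickle k) => [[n m]|]; first exact: NP.
  move=> [x [r r0 /(_ x)]]; rewrite subrr => /(_ (scale_disk0 _))/(_ _ ltr01).
  by case.
move=> x [n _ /SN[m _ Nx]]; exists (pickle (n, m)) => //.
by rewrite pickleK.
Qed.

Lemma not_meager_somewhere_dense (S : set E) : ~ meager S -> somewhere_dense S.
Proof.
move=> Sm; apply: contrapT => Snd; apply: Sm; exists (fun=> S) => // x Sx.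
by exists 0%N.
Qed.

(** The ball is recentred at 0: v is half the difference of x + v and x - v, and half the difference
    of their approximants lies again in S. *)
Lemma somewhere_dense_absolutely_convex (S : set E) :
  absolutely_convex S -> somewhere_dense S ->
  exists2 r : K, 0 < r & forall v, scale_set r B v -> forall s : K, 0 < s ->
    exists2 u, S u & scale_set s B (v - u).
Proof.
move=> cS [x [r r0 dS]]; exists r => // v rv s s0.
have [u1 Su1 u1s] : exists2 u, S u & scale_set s B (u - (x + v)).
  by apply: dS => //; rewrite addrC addKr.
have [u2 Su2 u2s] : exists2 u, S u & scale_set s B (u - (x - v)).
  by apply: dS => //; rewrite addrC addKr; exact: scale_setN.
exists (2^-1 *: u1 + (- 2^-1) *: u2).
  by apply: cS => //; rewrite normrN ger0_norm ?invr_ge0// -[2^-1]mul1r -splitr.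
have -> : v - (2^-1 *: u1 + (- 2^-1) *: u2) =
    2^-1 *: (u2 - (x - v)) + 2^-1 *: - (u1 - (x + v)).
  rewrite -scalerDr scaleNr -scalerBr.
  rewrite [in LHS](_ : v = 2^-1 *: (v + v)); last first.
    by rewrite scalerDr -scalerDl -[2^-1]mul1r -splitr scale1r.
  rewrite -scalerBr; congr (_ *: _); rewrite !opprB.
  by rewrite -[RHS]addrA !(addrA (v - x)) subrK addrCA.
rewrite [s]splitr (mulrC s); apply: scale_setD; rewrite ?mulr_ge0 ?ltW//.
  by apply: scale_setZ.
by apply/scale_setZ/scale_setN.
Qed.

End BanachDisks.

(** * De Wilde's closed graph theorem *)

Lemma choice2 (T U : Type) (P Q : T -> U -> Prop) :
  (forall x, exists2 y, P x y & Q x y) ->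
  exists2 f : T -> U, forall x, P x (f x) & forall x, Q x (f x).
Proof.
move=> PQ; have /choice[f fP] : forall x, exists y, P x y /\ Q x y.
  by move=> x; have [y] := PQ x; exists y.
by exists f => x; case: (fP x).
Qed.

Lemma nbhs0_translate (K : numFieldType) (E : tvsType K) (x : E) (U : set E) :
  nbhs x U -> nbhs 0 [set v | U (x + v)].
Proof.
move=> /(nbhsB (- x)); rewrite addNr; apply: filterS => _ [v Uv <-] /=.
by rewrite addNKr.
Qed.

Lemma linear_continuous_at0 (K : numFieldType) (E F : tvsType K)
    (T : {linear E -> F}) :
  (forall V, nbhs 0 V -> absolutely_convex V -> nbhs 0 (T @^-1` V)) ->
  continuous T.
Proof.
move=> T0 x U /nbhs0_translate/nbhs0_absolutely_convex[V [V0 cV VU]].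
apply: filterS (nbhsT x (T0 _ V0 cV)) => _ [v /VU Uv <-] /=.
by rewrite linearD.
Qed.

Lemma absolutely_convex_preimage (K : numFieldType) (E F : tvsType K)
    (T : {linear E -> F}) (V : set F) :
  absolutely_convex V -> absolutely_convex (T @^-1` V).
Proof. by move=> cV a b x y ab Vx Vy; rewrite /= linearP linearZ; exact: cV. Qed.

Section ClosedGraph.
Context (R : realType) (K : numFieldType) (hK : real_or_complex R K).
Context (E F : tvsType K) (T : {linear E -> F}).
Context (T_closed : forall (u : nat -> E) (x : E) (l : F),
  u @ \oo --> x -> T \o u @ \oo --> l -> l = T x).

(** Terms of a convergent series tend to 0: choosing in each [D k] a point violating the claim, if
    there is one, gives a series whose terms end up in V. *)
Lemma web_tail_sub (D : nat -> set F) (a : nat -> K) (V : set F) :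
  (forall k, D k !=set0) ->
  (forall x : nat -> F, (forall k, D k (x k)) ->
     exists l : F, series (fun k => a k *: x k : F) @ \oo --> l) ->
  nbhs 0 V -> exists N, forall k x, (N <= k)%N -> D k x -> V (a k *: x).
Proof.
move=> D0 aD V0; apply: contrapT => /forallNP noN.
have /choice[y yP] : forall k, exists y, D k y /\
    ((exists2 x, D k x & ~ V (a k *: x)) -> ~ V (a k *: y)).
  move=> k; have [[x Dx Vx]|nx] := pselect (exists2 x, D k x & ~ V (a k *: x)).
    by exists x.
  by have [y Dy] := D0 k; exists y.
have [//|l Sl] := aD y; first by move=> k; case: (yP k).
have Sl1 : (series (fun k => a k *: y k) n.+1 @[n --> \oo] --> l).
  by move=> U /Sl[M _ MU]; exists M => // n Mn; apply: MU; exact: leqW.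
have : (series (fun k => a k *: y k) n.+1 - series (fun k => a k *: y k) n)
    @[n --> \oo] --> l - l.
  exact: (cvg_comp (fun n => (series (fun k => a k *: y k) n.+1,
    series (fun k => a k *: y k) n)) _ (cvg_pair Sl1 Sl) (@sub_continuous F (l, l))).
rewrite subrr => /(_ _ V0)[N _ NV]; have /existsNP[k /existsNP[x]] := noN N.
move=> /not_implyP[Nk /not_implyP[Dx Vx]].
have [_ /(_ _)[]] := yP k; first by exists x.
by have := NV k Nk; rewrite /series/= big_nat_recr//= addrAC subrr add0r.
Qed.

(** Non-meagerness of the preimages selects a branch [i] of the web. Along it a point x of a small
    multiple of B is approximated successively, with errors tending to 0; the images form a
    convergent series of the web, whose sum is T x because the graph is closed. *)
Lemma closed_graph_disk (B : set E) (C : seq nat -> set F) (V : set F) :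
  Banach_disk B -> B !=set0 -> web C -> nbhs 0 V ->
  exists2 e : K, 0 < e & scale_set e B `<=` T @^-1` V.
Proof.
move=> hB B0 [cC CT Crec Cweb] V0; have [cB bB _] := hB.
have [V' V'0 VV] := nbhs0_split V0.
have [V1 [V10 cV1 V1V']] := nbhs0_absolutely_convex V'0.
have next s : exists n, ~ meager B (T @^-1` C s) ->
    ~ meager B (T @^-1` C (rcons s n)).
  have [m|nm] := pselect (meager B (T @^-1` C s)); first by exists 0%N.
  apply: contrapT => /forallNP sm; apply: nm; rewrite Crec preimage_bigcup.
  apply: (bigcup_meager hB B0) => n.
  by apply: contrapT => nm; apply: (sm n) => _.
have [g gP] := choice next.
pose p := fix p k := if k is j.+1 then rcons (p j) (g (p j)) else [::].
pose i k := g (p k).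
have pi k : mkseq i k = p k by elim: k => //= k IH; rewrite mkseqS IH.
have nm k : ~ meager B (T @^-1` C (mkseq i k)).
  rewrite pi; elim: k => [|k]; last exact: gP.
  by rewrite /= CT => /sub_meager sm; apply: (disk_span_not_meager hK hB B0); apply: sm.
pose D k := C (mkseq i k.+1).
have cD k : absolutely_convex (D k) by exact: cC.
have /choice2[r r0 rP] : forall k, exists2 r : K, 0 < r & forall v, scale_set r B v ->
    forall s : K, 0 < s -> exists2 u, D k (T u) & scale_set s B (v - u).
  move=> k; apply: (somewhere_dense_absolutely_convex hB).
    exact: absolutely_convex_preimage.
  exact/(not_meager_somewhere_dense)/nm.
have TD k : exists u, D k (T u).
  by have [u] := rP k 0 (scale_disk0 hB B0 _) 1 ltr01; exists u.
have D0 k : D k !=set0 by have [u] := TD k; exists (T u).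
have [a a0 aP] := Cweb i.
have [N NP] := web_tail_sub D0 aP V10.
(* The factors 2^-(k+1) have sum at most 1, which keeps the partial sums inside V1. *)
pose b k := a k * 2^-1 ^+ k.+1.
have b0 k : 0 < b k by rewrite mulr_gt0// exprn_gt0// invr_gt0.
(* [s k] bounds the error before step k: the first bound brings the error divided by [b k] into
   [r k] B, where [rP] applies; the second makes the errors tend to 0. *)
have /choice2[s s0 sP] : forall k, exists2 s : K, 0 < s & (s <= b k * r k) && (s <= 2^-1 ^+ k).
  by move=> k; apply: pos_lower_bound; rewrite ?mulr_gt0// exprn_gt0// invr_gt0.
have step (kv : nat * E) : exists u, D kv.1 (T u) /\
   (scale_set (s kv.1) B kv.2 -> scale_set (s kv.1.+1) B (kv.2 - b kv.1 *: u)).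
  case: kv => k v /=; have [sv|nsv] := pselect (scale_set (s k) B v); last first.
    by have [u Du] := TD k; exists u.
  have bk : b k != 0 by rewrite gt_eqF.
  have [|u Du uv] := rP k ((b k)^-1 *: v) _ _ (divr_gt0 (s0 k.+1) (b0 k)).
    apply: (scale_set_le cB _ _ (scale_setZ (b k)^-1 sv)).
      by rewrite mulr_ge0 ?invr_ge0 ?ltW.
    by rewrite mulrC ler_pdivrMr// mulrC; case/andP: (sP k).
  exists u; split=> // _; have := scale_setZ (b k) uv.
  by rewrite scalerBr scalerA divff// scale1r mulrC divfK.
have {step} [h' h'P] := choice step; pose h k v := h' (k, v).
exists (s N) => // x sx.
(* [z] is the remaining error. Nothing is done before index N, since only from N on does [a k] map
   [D k] into V1; there [y] takes the value 0, which still belongs to [D k]. *)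
pose z := fix z n := if n is m.+1
  then if (m < N)%N then z m else z m - b m *: h m (z m) else x.
pose y k := if (k < N)%N then 0 else 2^-1 ^+ k.+1 *: T (h k (z k)).
have e2 k : 0 <= (2^-1 : K) ^+ k by rewrite exprn_ge0 ?invr_ge0.
have e2' k : `|(2^-1 : K) ^+ k| <= 1.
  by rewrite ger0_norm// exprn_ile1// ?invr_ge0// invf_le1// ler1n.
have Dy k : D k (y k).
  rewrite /y; case: ifP => _; first exact: absolutely_convex0.
  by apply: absolutely_convexZ => //; case: (h'P (k, z k)).
have zx k : (k <= N)%N -> z k = x.
  by elim: k => //= k IH kN; rewrite kN IH// ltnW.
have zs k : (N <= k)%N -> scale_set (s k) B (z k).
  elim: k => [|k IH]; first by rewrite leqn0 => /eqP N0; move: sx; rewrite N0.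
  rewrite leq_eqVlt => /predU1P[<-|]; first by rewrite zx.
  rewrite ltnS => Nk /=; rewrite ltnNge Nk /=.
  by case: (h'P (k, z k)) => _; apply; exact: IH.
pose S := series (fun k => a k *: y k : F).
have SE n : S n = T (x - z n).
  rewrite /S /series /=; elim: n => [|n IH]; first by rewrite big_geq//= subrr linear0.
  rewrite big_nat_recr//= IH /y; case: ifP => _; first by rewrite scaler0 addr0.
  by rewrite scalerA opprB addrCA [RHS]linearD linearZ /= addrC.
have zx0 : (fun n => x - z n) @ \oo --> x.
  move=> U /nbhs0_translate/(bounded_scale_sub bB)[e e0 eU].
  have [M Me] := pow2_lt hK e0.
  exists (maxn M N) => // n /=; rewrite geq_max => /andP[Mn Nn].
  apply: (eU (- z n)); apply: scale_setN => //; apply: (scale_set_le cB _ _ (zs _ Nn)); first exact: ltW.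
  case/andP: (sP n) => _ /le_trans; apply; apply: le_trans (ltW Me).
  by rewrite ler_wiXn2l ?invr_ge0// invf_le1// ler1n.
have [l Sl] := aP y Dy.
have lT : l = T x.
  by apply: (T_closed zx0); rewrite [T \o _](_ : _ = S)//; apply/funext => n; rewrite SE.
have SV n : scale_set (1 - 2^-1 ^+ n) V1 (S n).
  have V1_0 : V1 0 by exact: nbhs_singleton.
  rewrite /S /series /=; elim: n => [|n IH].
    by rewrite big_geq// expr0 subrr; exists 0; rewrite ?scaler0.
  rewrite big_nat_recr//= [1 - _](_ : _ = (1 - 2^-1 ^+ n) + 2^-1 ^+ n.+1); last first.
    by rewrite exprS; field.
  apply: scale_setD => //.
    by rewrite subr_ge0 exprn_ile1// ?invr_ge0// invf_le1// ler1n.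
  rewrite /y; case: ltnP => nN; first by exists 0; rewrite ?scaler0.
  exists (a n *: T (h n (z n))); first by apply: NP => //; case: (h'P (n, z n)).
  by rewrite !scalerA mulrC.
have {}SV n : V1 (S n).
  have [v Vv <-] := SV n; apply: absolutely_convexZ => //.
  by rewrite ger0_norm ?gerBl// subr_ge0 exprn_ile1// ?invr_ge0// invf_le1// ler1n.
(* T x is only a limit of points of V1; sums of two elements of V1 lie in V, which absorbs the last
   error. *)
have [M _ /(_ M (leqnn M))[v Vv lv]] := Sl _ (nbhsT l V10).
rewrite /= -lT (_ : l = S M + - v); last by rewrite /S -lv addrK.
apply: VV; apply: V1V' => //; rewrite -scaleN1r.
by apply: absolutely_convexZ; rewrite // normrN1.
Qed.

(** In an ultrabornological space it suffices that the preimage of V absorbs every Banach disk. *)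
Theorem closed_graph : ultrabornological E -> webbed F -> continuous T.
Proof.
move=> uE [C hC]; apply: linear_continuous_at0 => V V0 cV.
apply: uE => [|B hB]; first exact: absolutely_convex_preimage.
have [->|/set0P B0] := eqVneq B set0.
  by exists 1 => // c _; exact: sub0set.
have [e e0 eV] := closed_graph_disk hB B0 hC V0.
by apply: absorbs_scale_sub e0 eV; case: hB.
Qed.

End ClosedGraph.

(** * Continuous seminorms and the Banach-Steinhaus theorem *)

Lemma seminorm_continuous (K : numFieldType) (E : tvsType K) (p : E -> K) :
  (forall x, 0 <= p x) -> (forall x y, p (x + y) <= p x + p y) ->
  (forall (a : K) x, p (a *: x) = `|a| * p x) ->
  nbhs 0 [set x | p x <= 1] -> continuous (p : E -> K^o).
Proof.
move=> p0 pD pZ p1 x; apply/cvgrPdist_lt => e e0.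
have e20 : e / 2 != 0 by rewrite gt_eqF// divr_gt0.
apply: filterS (nbhsT x (nbhs0Z e20 p1)) => _ [_ [y /= py <-] <-].
set v := (e / 2) *: y.
have pv : p v <= e / 2.
  by rewrite pZ gtr0_norm ?divr_gt0// ler_piMr// ltW// divr_gt0.
have pN : p (- v) = p v by rewrite -scaleN1r pZ normrN1 mul1r.
apply: (@le_lt_trans _ _ (e / 2)); last by rewrite ltr_pdivrMr// ltr_pMr// ltr1n.
rewrite real_ler_norml; last by rewrite rpredB// ger0_real.
apply/andP; split.
  by rewrite lerNl opprB lerBlDl (le_trans (pD _ _))// lerD2l.
by rewrite lerBlDr addrC -{1}(addrK v x) (le_trans (pD _ _))// pN lerD2l.
Qed.

Section BanachSteinhaus.
Context (R : realType) (K : numFieldType) (hK : real_or_complex R K).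
Context (E : tvsType K) (uE : ultrabornological E).
Context (I : Type) (phi : I -> E -> K).
Context (phi_linear : forall i (a : K) x y, phi i (a *: x + y) = a * phi i x + phi i y).
Context (phi_continuous : forall i, continuous (phi i : E -> K^o)).
Context (phi_bounded : forall x, exists b : K, forall i, `|phi i x| <= b).

Let phi0 i : phi i 0 = 0.
Proof. by have := phi_linear i (-1) 0 0; rewrite scaler0 addr0 mulN1r addNr. Qed.

Let phiZ i (a : K) x : phi i (a *: x) = a * phi i x.
Proof. by rewrite -[a *: x]addr0 phi_linear phi0 addr0. Qed.

Let phiD i x y : phi i (x + y) = phi i x + phi i y.
Proof. by rewrite -[x]scale1r phi_linear scale1r mul1r. Qed.

(** By Baire, some set of uniform bound n is somewhere dense in the span of a given Banach disk B,
    so each point of some r B is approximated by points of that set. The error may be chosen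
    depending on i, by continuity of [phi i], and this yields the bound n + 1 on r B. *)
Lemma nbhs0_uniformly_bounded :
  nbhs 0 [set x | forall i, `|phi i x| <= 1].
Proof.
have cS (r : K) : 0 <= r -> absolutely_convex [set x | forall i, `|phi i x| <= r].
  move=> r0 a b x y ab xS yS i; rewrite phiD !phiZ (le_trans (ler_normD _ _))//.
  rewrite !normrM (@le_trans _ _ (`|a| * r + `|b| * r))//.
    by rewrite lerD// ler_wpM2l.
  by rewrite -mulrDl ler_piMl.
apply: uE => [|B hB]; first exact: cS.
have [->|/set0P B0] := eqVneq B set0.
  by exists 1 => // c _; exact: sub0set.
have [cB bB _] := hB.
pose N (n : nat) := [set x | forall i, `|phi i x| <= n%:R].
have [n nN] : exists n, somewhere_dense B (N n).
  apply: contrapT => /forallNP nN.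
  apply: (disk_span_not_meager hK hB B0); exists N => // x _.
  have [b bx] := phi_bounded x.
  (* If 0 <= b fails, the index type is empty and any n will do. *)
  have [b0|b0] := pselect (0 <= b).
    have [n bn] := nonneg_lt_nat hK b0; exists n => // i.
    by rewrite (le_trans (bx i))// ltW.
  by exists 0%N => // i; case: b0; exact: le_trans (bx i).
have [r r0 rP] := somewhere_dense_absolutely_convex hB (cS _ (ler0n K n)) nN.
have n0 : 0 < n%:R + 1 :> K by rewrite natr1 ltr0n.
apply: (@absorbs_scale_sub _ _ _ _ ((n%:R + 1)^-1 * r)) => //.
  by rewrite mulr_gt0// invr_gt0.
move=> _ [x Bx <-] i; rewrite -scalerA phiZ normrM gtr0_norm ?invr_gt0//.
rewrite mulrC ler_pdivrMr// mul1r.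
have : nbhs 0 [set x | `|phi i x| < 1].
  have /cvgrPdist_lt/(_ 1 ltr01) := phi_continuous (i := i) (x := 0).
  by apply: filterS => y /=; rewrite phi0 sub0r normrN.
move=> /(bounded_scale_sub bB)[e e0 eB].
have [|u Nu uv] := rP (r *: x) _ e e0; first by exists x.
rewrite -(subrK u (r *: x)) phiD addrC (le_trans (ler_normD _ _))// lerD//.
by rewrite ltW//; exact: eB.
Qed.

Lemma sup_continuous_seminorm : exists2 p : E -> K, continuous_seminorm p &
  forall x, (forall i, `|phi i x| <= p x) /\
    forall u, 0 <= u -> (forall i, `|phi i x| <= u) -> p x <= u.
Proof.
have /choice[p pP] : forall x, exists s, [/\ 0 <= s, forall i, `|phi i x| <= s &
    forall u, 0 <= u -> (forall i, `|phi i x| <= u) -> s <= u].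
  move=> x; have [b bx] := phi_bounded x.
  (* Adjoining 0 and taking [|b|] as bound covers an empty index type. *)
  have [||s sub sle] := @nonneg_has_lub _ _ hK
      [set y | y = 0 \/ exists i, y = `|phi i x|] `|b|.
  - by exists 0; left.
  - move=> _ [->|[i ->]]; first by rewrite lexx normr_ge0.
    rewrite normr_ge0 (le_trans (bx i))// ger0_norm//.
    exact: le_trans (bx i).
  - exists s; split; first by apply: sub; left.
      by move=> i; apply: sub; right; exists i.
    by move=> u u0 ux; apply: sle => _ [->|[i ->]].
have p0 x : 0 <= p x by case: (pP x).
have phip i x : `|phi i x| <= p x by case: (pP x).
have ple x u : 0 <= u -> (forall i, `|phi i x| <= u) -> p x <= u.
  by case: (pP x) => _ _; exact.
have pZle (a : K) x : p (a *: x) <= `|a| * p x.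
  by apply: ple => [|i]; rewrite ?mulr_ge0// phiZ normrM ler_wpM2l.
exists p; last by move=> x; split=> // u; exact: ple.
have pD x y : p (x + y) <= p x + p y.
  apply: ple => [|i]; first exact: addr_ge0.
  by rewrite phiD (le_trans (ler_normD _ _))// lerD.
have pZ (a : K) x : p (a *: x) = `|a| * p x.
  apply/le_anti; rewrite pZle /=; have [->|a0] := eqVneq a 0.
    by rewrite normr0 mul0r.
  rewrite mulrC -ler_pdivlMr ?normr_gt0// mulrC -normfV.
  by rewrite -[x in p x <= _](scalerK a0).
split=> //; apply: seminorm_continuous => //.
by apply: filterS nbhs0_uniformly_bounded => x; exact: ple.
Qed.

End BanachSteinhaus.

(** * Countable products, compactness in subspaces, iterates *)

(** The sets containing such a finitely constrained box form a filter; as the product topology is a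
    supremum, its convergence to g is checked one coordinate at a time. *)
Lemma nbhs_prod_nat (T : nat -> topologicalType)
    (g : prod_topology T) (O : set (prod_topology T)) :
  nbhs g O -> exists N, exists2 V : forall i, set (T i),
    forall i, nbhs (g i) (V i) &
    forall f : prod_topology T, (forall i, (i <= N)%N -> V i (f i)) -> O f.
Proof.
move=> gO.
pose G : set_system (prod_topology T) :=
  [set P | exists N, exists2 V : forall i, set (T i),
    forall i, nbhs (g i) (V i) &
    forall f : prod_topology T, (forall i, (i <= N)%N -> V i (f i)) -> P f].
have GF : Filter G.
  split.
  - by exists 0%N, (fun=> setT) => // i; exact: filterT.
  - move=> P Q [N [V gV VP]] [M [W gW WQ]].
    exists (maxn N M), (fun i => V i `&` W i) => [i|f fVW]; first exact: filterI.
    split; [apply: VP|apply: WQ] => i iN.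
      by case: (fVW i) => //; rewrite leq_max iN.
    by case: (fVW i) => //; rewrite leq_max iN orbT.
  - by move=> P Q PQ [N [V gV VP]]; exists N, V => // f /VP/PQ.
suff : G --> g by move=> /(_ _ gO).
apply/cvg_sup => i P [_ [[Q oQ <-] Qg QP]].
(* This is Q at the coordinate i and the whole space elsewhere, with a transport for the dependent
   type. *)
exists i, (fun k => [set x | forall e : k = i, Q (ecast k (T k) e x)]).
  move=> k; have [e|ne] := pselect (k = i); last first.
    by apply: filterS filterT => x _ e.
  subst k; apply: (@filterS _ _ _ Q); last by apply: open_nbhs_nbhs.
  by move=> x Qx e; rewrite (Prop_irrelevance e (erefl i)).
by move=> f /(_ i (leqnn i) (erefl i)) Qf; apply: QP.
Qed.

Lemma compact_val_preimage (T : topologicalType) (X S : set T) :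
  S `<=` X -> compact S -> compact [set y : X | S (\val y)].
Proof.
move=> SX cS G GP GS.
have [s [Ss sG]] := cS ((\val : X -> T) @ G) _ GS.
exists (exist _ s (mem_set (SX _ Ss))); split=> //.
move=> P Q GP' [_ [[D oD <-] Ds DQ]].
have [||_ [[y Py <-] Dy]] := sG [set \val y | y in P] D.
- by rewrite /fmap /=; apply: filterS GP' => y Py; exists y.
- exact: open_nbhs_nbhs.
- by exists y; split=> //; apply: DQ.
Qed.

Lemma iter_continuous (T : topologicalType) (f : T -> T) (m : nat) :
  continuous f -> continuous (iter m f).
Proof.
move=> cf; elim: m => [|m IH] x /=; first exact: cvg_id.
by apply: continuous_comp; [exact: IH|exact: cf].
Qed.

(** * Restriction maps and gluing *)

Section Restrictions.
Context (R : realType) (K : numFieldType) (hK : real_or_complex R K).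
Context (Omega : topologicalType) (F : forall X : set Omega, function_space K X).
Context (sheaf_F : is_sheaf F).

Lemma val_at0 (X : set Omega) (x : X) : val_at (0 : F X) x = 0.
Proof.
have := val_at_linear (-1) (0 : F X) 0 x.
by rewrite scaler0 addr0 mulN1r addNr.
Qed.

Lemma val_atZ (X : set Omega) (a : K) (f : F X) (x : X) :
  val_at (a *: f) x = a * val_at f x.
Proof. by rewrite -[a *: f]addr0 val_at_linear val_at0 addr0. Qed.

Section OpenSubset.
Context (X Y : set Omega) (oX : open X) (oY : open Y) (YX : Y `<=` X).

Lemma val_restr (f : F X) (x : X) (y : Y) :
  \val x = \val y -> val_at (restr Y f) y = val_at f x.
Proof.
move=> xy; have [sub _ _] := sheaf_F.
have /(xgetPex 0) := sub X Y oX oY YX f.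
by move=> /(_ x y xy) ->.
Qed.

Lemma restr_eq (f : F X) (g : F Y) : coincide f g -> restr Y f = g.
Proof.
move=> fg; apply: val_at_inj; apply/funext => y.
pose x : X := exist _ (\val y) (mem_set (YX (set_valP y))).
by rewrite (@val_restr f x y)// (fg x y).
Qed.

Lemma restr_linear : linear (restr Y : F X -> F Y).
Proof.
move=> a f g; apply: restr_eq => x y xy.
by rewrite !val_at_linear !(val_restr _ xy).
Qed.

(* The closed graph theorem is needed here: Y need not be sigma-compact, hence
   may have no exhaustion, and then (F1) does not describe its topology. *)
Lemma restr_continuous : property_F1 F -> continuous (restr Y : F X -> F Y).
Proof.
move=> F1; have [[_ uX _] _ deltaX _] := F1 X oX.
have [[wY _ _] _ deltaY _] := F1 Y oY.
pose T : {linear F X -> F Y} := HB.pack (restr Y : F X -> F Y)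
  (GRing.isLinear.Build K (F X) (F Y) *:%R (restr Y) restr_linear).
(* The graph is closed because point evaluations are continuous on both spaces and determine a
   function. *)
apply: (closed_graph hK (T := T)) => // u f g uf ug.
apply: val_at_inj; apply/funext => y.
pose x : X := exist _ (\val y) (mem_set (YX (set_valP y))).
have -> : val_at (T f) y = val_at f x by exact: val_restr.
have gy : (fun n => val_at (restr Y (u n)) y : K^o) @ \oo --> (val_at g y : K^o).
  exact: (cvg_comp _ _ ug (deltaY y g)).
have fx : (fun n => val_at (u n) x : K^o) @ \oo --> (val_at f x : K^o).
  exact: (cvg_comp _ _ uf (deltaX x f)).
apply: (cvg_unique (@norm_hausdorff K K^o) gy).
rewrite (_ : (fun n => _) = (fun n => val_at (u n) x))//.
by apply/funext => n; exact: val_restr.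
Qed.

End OpenSubset.

Lemma restr_restr (X Y Z : set Omega) (f : F X) :
  open X -> open Y -> open Z -> Z `<=` Y -> Y `<=` X ->
  restr Z (restr Y f) = restr Z f.
Proof.
move=> oX oY oZ ZY YX; apply: restr_eq => // y z yz.
pose x : X := exist _ (\val y) (mem_set (YX _ (set_valP y))).
rewrite (@val_restr _ _ oX oY YX f x y)//.
by rewrite (@val_restr _ _ oX oZ (subset_trans ZY YX) f x z).
Qed.

Lemma glue_disjoint (Y Z : set Omega) (f : F Y) (g : F Z) :
  open Y -> open Z -> (forall x, Y x -> Z x -> False) ->
  exists h : F (Y `|` Z), coincide h f /\ coincide h g.
Proof.
move=> oY oZ YZ; have [_ _ glue] := sheaf_F.
pose U (b : bool) := if b then Y else Z.
pose k (b : bool) : F (U b) := match b with true => f | false => g end.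
have [|||h hk] := glue (Y `|` Z) _ bool U _ k.
- exact: openU.
- split; first by case.
  apply/seteqP; split=> [x [[] _]|x [Yx|Zx]]; [by left|by right| |].
    by exists true.
  by exists false.
- case=> [] [] x y xy; try by congr val_at; apply: val_inj.
  + by case: (YZ (\val x)); [exact: set_valP|rewrite xy; exact: set_valP].
  + by case: (YZ (\val x)); [rewrite xy; exact: set_valP|exact: set_valP].
by exists h; split; [exact: (hk true)|exact: (hk false)].
Qed.

End Restrictions.

(** * Iterated weights, exhaustions and seminorms on the projective limit *)

Lemma val_at_iter (K : numFieldType) (Omega : topologicalType)
    (F : forall X : set Omega, function_space K X) (X : set Omega)
    (w : X -> K) (psi : X -> X) (C : F X -> F X) (m : nat) (f : F X) (x : X) :
  weighted_composition w psi C ->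
  val_at (iter m C f) x =
    (\prod_(i < m) w (iter i psi x)) * val_at f (iter m psi x).
Proof.
move=> hC; elim: m x => [|m IH] x; first by rewrite big_ord0 mul1r.
rewrite iterS hC IH big_ord_recl /= mulrA; congr (_ * _ * _).
  by apply: eq_bigr => i _; rewrite -iterSr.
by rewrite -iterSr.
Qed.

(** Each factor is nonzero on a dense open set; the induction shrinks G by the set of the last
    factor. *)
Lemma exists_iter_neq0 (K : numFieldType) (T : topologicalType)
    (w : T -> K) (psi : T -> T) (m : nat) (G : set T) :
  continuous (w : T -> K^o) -> continuous psi ->
  (forall m, dense [set y | w (iter m psi y) != 0]) ->
  open G -> G !=set0 ->
  exists2 y, G y & \prod_(i < m) w (iter i psi y) != 0.
Proof.
move=> cw cpsi dw; elim: m G => [|m IH] G oG G0.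
  by have [y Gy] := G0; exists y; rewrite // big_ord0 oner_neq0.
have [||y [Gy wy] py] := IH (G `&` [set y | w (iter m psi y) != 0]).
- apply: openI => //.
  apply: (@open_comp _ _ (fun y => w (iter m psi y) : K^o) [set x | x != 0]).
    move=> y _; apply: continuous_comp; last exact: cw.
    exact: iter_continuous.
  rewrite (_ : [set x | _] = ~` [set 0]); last first.
    by apply/seteqP; split=> x /eqP.
  apply/closed_openC/accessible_closed_set1/hausdorff_accessible.
  exact: (@norm_hausdorff K K^o).
- exact: dw.
- by exists y; rewrite // big_ord_recr mulf_neq0.
Qed.

(** A neighbourhood of 0 in the projective limit constrains only finitely many coordinates. *)
Lemma small_on_restrictions (K : numFieldType) (Omega : topologicalType)
    (F : forall X : set Omega, function_space K X) (sheaf_F : is_sheaf F)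
    (X : set Omega) (oX : open X) (Xn : nat -> set Omega)
    (q : F X -> K) :
  (forall n, open (Xn n) /\ Xn n `<=` X) ->
  topological_iso_projective_limit F X Xn -> continuous_seminorm q ->
  exists N, exists2 V : forall i, set (F (Xn i)),
    forall i, nbhs 0 (V i) &
    forall f : F X, (forall i, (i <= N)%N -> V i (restr (Xn i) f)) -> q f < 1.
Proof.
move=> oXn [_ Xlim [h hK ch]] [q0 qD qZ cq].
have lim (f : F X) : @projective_limit K Omega F Xn (restr_seq Xn f).
  by rewrite -Xlim; exists f.
have restr0 i : restr (Xn i) (0 : F X) = 0.
  have [oi iX] := oXn i.
  by apply: (restr_eq sheaf_F) => // x y _; rewrite !val_at0.
have qlt1 : nbhs (0 : F X) [set f | q f < 1].
  have q00 : q 0 = 0 by rewrite -(scale0r (0 : F X)) qZ normr0 mul0r.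
  have /cvgrPdist_lt/(_ 1 ltr01) := cq 0.
  by apply: filterS => f /=; rewrite q00 sub0r normrN ger0_norm.
(* Continuity of [h] is given only within the projective limit, hence the implication. *)
have : nbhs (restr_seq Xn (0 : F X))
    [set g | @projective_limit K Omega F Xn g -> q (h g) < 1].
  have qh : nbhs (h (restr_seq Xn (0 : F X))) [set f | q f < 1] by rewrite hK.
  have := ch _ _ qh; rewrite nbhs_simpl /= /nbhs /= -nbhs_subspace_in//.
move=> /nbhs_prod_nat[N [V gV VP]]; exists N, V => [i|f fV].
  by have := gV i; rewrite /restr_seq restr0.
by have := VP (restr_seq Xn f) fV (lim f); rewrite hK.
Qed.

Lemma subset_exhaustion (T : topologicalType) (X : set T) (Xn : nat -> set T)
    (i j : nat) :
  exhaustion X Xn -> (i <= j)%N -> Xn i `<=` Xn j.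
Proof.
move=> [_ _ XS _]; elim: j => [|j IH]; first by rewrite leqn0 => /eqP ->.
rewrite leq_eqVlt => /predU1P[-> //|]; rewrite ltnS => /IH ij.
by apply: (subset_trans ij); apply: subset_trans (XS j); exact: subset_closure.
Qed.

Lemma compact_sub_exhaustion (T : topologicalType) (X : set T)
    (Xn : nat -> set T) (A : set X) :
  exhaustion X Xn -> compact A -> exists j, forall y : X, A y -> Xn j (\val y).
Proof.
move=> hX; have [oX _ _ XE] := hX; move=> /compact_near_coveringP cA.
have [|j _ /(_ j (leqnn j)) jP] := cA nat \oo (fun n y => Xn n (\val y)) _.
  move=> y _; have [n _ ny] : (\bigcup_n Xn n) (\val y).
    by rewrite XE; exact: set_valP.
  exists ([set z : X | Xn n (\val z)], [set m | (n <= m)%N]).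
    split; last by exists n.
    apply: open_nbhs_nbhs; split=> //; exists (Xn n) => //.
    by case: (oX n).
  by move=> [z m] [/= nz nm]; exact: subset_exhaustion hX nm _ nz.
by exists j => y; exact: jP.
Qed.

Lemma compact_bounded_function (R : realType) (K : numFieldType)
    (T : topologicalType) (f : T -> K) (A : set T) :
  real_or_complex R K -> continuous (f : T -> K^o) -> compact A ->
  exists b : K, forall y, A y -> `|f y| <= b.
Proof.
move=> hK cf /compact_near_coveringP cA.
have [|j _ /(_ j (leqnn j)) jP] := cA nat \oo (fun n y => `|f y| <= n%:R) _.
  move=> y _; have [n fn] := nonneg_lt_nat hK (normr_ge0 (f y)).
  exists ([set z | `|f y - f z| < n%:R - `|f y|], [set m | (n <= m)%N]).
    split; last by exists n.
    by have /cvgrPdist_lt := cf y; apply; rewrite subr_gt0.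
  move=> [z m] [/= zn nm]; apply: (@le_trans _ _ n%:R); last by rewrite ler_nat.
  rewrite -(subrK (f y) (f z)) (le_trans (ler_normD _ _))//.
  by rewrite -lerBrDr distrC ltW.
by exists j%:R => y; exact: jP.
Qed.

(** * Topologizability against escaping orbits *)

Theorem proposition3p4
  (R : realType) (K : numFieldType) (hK : real_or_complex R K)
  (Omega : topologicalType)
  (hausdorff_Omega : hausdorff_space Omega)
  (locally_compact_Omega : locally_compact [set: Omega])
  (sigma_compact_Omega : sigma_compact Omega)
  (noncompact_Omega : ~ compact [set: Omega])
  (F : forall X : set Omega, function_space K X)
  (sheaf_F : is_sheaf F) (F1 : property_F1 F)
  (X : set Omega) (openX : open X)
  (w : X -> K) (psi : X -> X)
  (cont_w : continuous (w : X -> K^o)) (cont_psi : continuous psi)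
  (C : F X -> F X) (hC : weighted_composition w psi C)
  (ha : exists2 Xn : nat -> set Omega, exhaustion X Xn &
     forall (n : nat) (x : Omega), (X `\` closure (Xn n)) x ->
     forall W : set Omega, open W -> W `<=` X `\` closure (Xn n) -> W x ->
     exists U : set Omega,
       [/\ open U, U `<=` W, U x
         & dense (range (restr (Xn n `|` U) : F X -> F (Xn n `|` U)))])
  (hb : forall x : X, [set f : F X | val_at f x = 0] <> [set: F X])
  (hc : forall m : nat, dense [set y : X | w (iter m psi y) != 0])
  (topC : topologizable C) :
  stable_orbits psi.
Proof.
have [Xn hX dense_restr] := ha; have [oXn cXn XnS XnE] := hX.
have clX n : closure (Xn n) `<=` X.
  by apply: subset_trans (XnS n) _; case: (oXn n.+1).
have [[_ uX _] cF deltaX limX] := F1 X openX.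
have c_cl n : compact [set y : X | closure (Xn n) (\val y)].
  exact: compact_val_preimage.
move=> A cA; have [j Aj] := compact_sub_exhaustion hX cA.
pose I := {y : X | closure (Xn j) (\val y)}.
have [p sp pP] := @sup_continuous_seminorm R K hK (F X) uX I
  (fun i f => val_at f (sval i)) (fun i a f g => val_at_linear a f g (sval i))
  (fun i => deltaX (sval i))
  (fun f => let: ex_intro b bP := compact_bounded_function hK (cF f) (c_cl j) in
    ex_intro _ b (fun i => bP (sval i) (svalP i))).
have [q sq qP] := topC p sp.
have [N [V V0 VP]] := small_on_restrictions sheaf_F openX oXn (limX Xn hX) sq.
(* N comes from q, which is chosen before m, so one compact set serves all m. *)
exists [set y : X | closure (Xn N) (\val y)] => // m m0 _ [x Ax <-].
apply: contrapT => /= xN; have [gamma gamma0 gammaP] := qP m m0.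
have cval : continuous (\val : X -> Omega) by exact: initial_continuous.
have [||y [yj yN] wy] := @exists_iter_neq0 K X w psi m
  [set y : X | Xn j (\val y) /\ (~` closure (Xn N)) (\val (iter m psi y))]
  cont_w cont_psi hc.
- apply: openI; apply: open_comp.
  + by move=> y _; exact: cval.
  + by case: (oXn j).
  + move=> y _; apply: (@continuous_comp _ _ _ (iter m psi) (\val : X -> Omega)).
      exact: iter_continuous.
    exact: cval.
  + exact/closed_openC/closed_closure.
- by exists x; split=> //; exact: Aj.
set P := \prod_(i < m) _ in wy; set z := iter m psi y in yN.
have oD : open (X `\` closure (Xn N)).
  by apply: openI => //; exact/closed_openC/closed_closure.
have zD : (X `\` closure (Xn N)) (\val z) by split=> //; exact: set_valP.
have [U [oU UD Uz dU]] := dense_restr N (\val z) zD _ oD (@subset_refl _ _) zD.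
have UX : U `<=` X by move=> u /UD [].
have [oN NX] := oXn N.
have YX : Xn N `|` U `<=` X by move=> u [/NX|/UX].
have oY : open (Xn N `|` U) by exact: openU.
have [f0 f0z] : exists f0 : F X, val_at f0 z != 0.
  apply: contrapT => /forallNP f0z; apply: (hb z); apply/seteqP; split=> // f _.
  by apply/eqP/negPn/negP; exact: f0z.
pose zU : U := exist _ (\val z) (mem_set Uz).
pose zY : (Xn N `|` U : set _) := exist _ (\val z) (mem_set (or_intror Uz)).
have P0 : 0 < `|P| by rewrite normr_gt0.
(* An f with |f z - c| < 1 has |P| |f z| > gamma, which exceeds gamma q f once q f < 1. *)
pose c := 1 + gamma / `|P|.
have c0 : 0 < c by rewrite addr_gt0// divr_gt0.
have [h [hN hU]] := glue_disjoint sheaf_F (0 : F (Xn N))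
  ((c / val_at f0 z) *: restr U f0 : F U) oN oU
  (fun x Nx Ux => (UD x Ux).2 (subset_closure Nx)).
have hz : val_at h zY = c.
  by rewrite (hU zY zU)// val_atZ (val_restr sheaf_F openX oU UX _ (x := z))// divfK.
have iN i : (i <= N)%N -> Xn i `<=` Xn N `|` U.
  by move=> iN; apply: subset_trans (subset_exhaustion hX iN) _ => u; left.
have h0 i : (i <= N)%N -> restr (Xn i) h = 0.
  move=> le_iN; apply: (restr_eq sheaf_F oY (oXn i).1 (iN i le_iN)) => a b ab.
  pose a' : Xn N := exist _ (\val b)
    (mem_set (subset_exhaustion hX le_iN (set_valP b))).
  by rewrite (hN a a')// !val_at0.
(* The glued h has value c at z and vanishes on each X_i with i <= N, so continuity of evaluation
   and restrictions makes these conditions hold near h, where density of the range supplies f. *)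
have hO : nbhs h [set g | `|val_at g zY - c| < 1 /\
    forall i : 'I_N.+1, V i (restr (Xn i) g)].
  have [_ _ deltaY _] := F1 _ oY.
  apply: filterI.
    have /cvgrPdist_lt/(_ 1 ltr01) := deltaY zY h.
    by apply: filterS => g /=; rewrite hz distrC.
  apply: filter_forall => i; have le_iN : (i <= N)%N by rewrite -ltnS.
  have := restr_continuous hK sheaf_F oY (oXn i).1 (iN i le_iN) F1 (x := h).
  by apply; rewrite (h0 _ le_iN); exact: V0.
move: hO; rewrite nbhsE => -[D [oD' Dh] DO].
have [|g [/DO gO [f _ fE]]] := dU D _ oD'; first by exists h.
move: gO; rewrite -{g}fE => -[fc fV].
have fz : `|val_at f z - c| < 1.
  by rewrite -(val_restr sheaf_F openX oY YX f (x := z) (y := zY)).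
have qf : q f < 1.
  apply: VP => i le_iN; have := fV (Ordinal (le_iN : (i < N.+1)%N)).
  by rewrite /= (restr_restr sheaf_F f openX oY (oXn i).1 (iN i le_iN) YX).
have yI : closure (Xn j) (\val y) by exact: subset_closure.
have := (pP (iter m C f)).1 (exist _ y yI).
rewrite /= (val_at_iter m f y hC) normrM -/P -/z => /le_trans/(_ (gammaP f)).
move=> le_q; suff /lt_le_trans/(_ le_q) : gamma * q f < `|P| * `|val_at f z|.
  by rewrite ltxx.
apply: (@lt_trans _ _ gamma); first by rewrite gtr_pMr.
rewrite -ltr_pdivrMl// mulrC -(ltrD2l 1) -/c.
rewrite -[X in X < _](gtr0_norm c0) -[X in `|X|](subKr (val_at f z)).
by rewrite (le_lt_trans (ler_normB _ _))// addrC ltrD2r.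
Qed.
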